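(* Let $\{\hat F_t\}_{t\in\mathbb{N}}$ be a sequence of i.i.d. random row-stochastic matrices in $[0,1]^{m\times n}$ such that $\mathbb{E}[\hat F_t]=F$ and $\|\hat F_t-F\|_\infty\le\mu$, and let $h:\mathbb{R}^m\to\mathbb{R}^n$ be a model-independent feedback control law satisfying, for some $\alpha\in[0,1)$, all $R\le 0$ and all $i\in\{1,\dots,n\}$, $$h(R)\in\mathcal{F}^I(R),\qquad h^i(R)+\gamma\|h(R)\|_\infty\le h_{\max}^i(R)+\alpha\|h_{\max}(R)\|_\infty.$$ Let $R_0\le 0$ and let $\{R_t\}$, $\{\hat R_t\}$ be the nominal and perturbed updates $$R_{t+1}=R_t+(\gamma F-S)h(R_t),\qquad \hat R_{t+1}=\hat R_t+(\gamma\hat F_t-S)h(\hat R_t),\quad \hat R_0=R_0.$$ Then $$\mathbb{P}\Bigl(\sup_{t\in\mathbb{N}}\|\hat R_t-R_t\|_\infty\ge\varepsilon\Bigr)\le 2\exp\Bigl(-c\,\frac{(\varepsilon-\varepsilon_{\min})^2}{\|h_{\max}(R_0)\|_\infty^2}\Bigr)$$ for all $\varepsilon\ge\varepsilon_{\min}$, where $$\varepsilon_{\min}:=2\,\frac{1+\gamma}{(1-\alpha)(1-\gamma)}\|h_{\max}(R_0)\|_\infty,\qquad c:=\frac{(1-\alpha^2)(1-\gamma)^2}{2\mu^2\gamma^2}.$$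
   Context: States are $\{1,\dots,n\}$; actions are $\{1,\dots,m\}$, partitioned into nonempty sets $U_1,\dots,U_n$ ($U_i$ = actions available in state $i$). $F\in[0,1]^{m\times n}$ is a row-stochastic matrix (the true transition model), $\gamma\in[0,1)$ the discount factor, and $S\in\{0,1\}^{m\times n}$ has $S^j_i=1$ iff $j\in U_i$. For matrices $\|\cdot\|_\infty$ is the operator norm induced by the vector $\infty$-norm (maximum absolute row sum). The map $h_{\max}:\mathbb{R}^m\to\mathbb{R}^n$ is $h_{\max}^i(R)=\max_{j\in U_i}R^j$. For $R\le 0$ (componentwise), $$\mathcal{F}^I(R):=\{\Delta\in\mathbb{R}^n:\ 0\ge\Delta^i\ge\gamma\Delta^k+R^j\ \ \forall i,k\in\{1,\dots,n\},\ \forall j\in U_i\}.$$ ''Model-independent'' means $h$ is a fixed function of the reward vector that does not depend on the realizations $\hat F_t$. *)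

(* Defs.v *)
From HB Require Import structures.
From mathcomp Require Export all_boot all_order all_algebra finmap.
From mathcomp Require Export all_classical all_reals all_analysis.
Export numFieldNormedType.Exports.

Set Implicit Arguments.
Unset Strict Implicit.
Unset Printing Implicit Defensive.

Import Order.TTheory GRing.Theory Num.Theory.

Local Open Scope classical_set_scope.
Local Open Scope ring_scope.

Section MDP.
Variable R : realType.
Implicit Types m n : nat.

Definition row_stochastic m n (A : 'M[R]_(m, n)) : Prop :=
  (forall j i, 0 <= A j i <= 1) /\ (forall j, \sum_i A j i = 1).

Definition action_partition m n (U : 'I_n -> {set 'I_m}) : Prop :=
  (forall i, U i != finset.set0) /\ (forall j, exists! i, j \in U i).

Definition selection_mx m n (U : 'I_n -> {set 'I_m}) : 'M[R]_(m, n) :=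
  \matrix_(j, i) (j \in U i)%:R.

(* On column vectors the library norm `|x| is the oo-norm; on other matrices
   it is the largest absolute entry, hence the need for a separate norm. *)
Definition opnorm m n (A : 'M[R]_(m, n)) : R :=
  sup [set `|A *m x| | x in [set x : 'cV[R]_n | `|x| <= 1]].

(* The maximum over the nonempty finite set U i, see [hmaxP]. *)
Definition hmax m n (U : 'I_n -> {set 'I_m}) (r : 'cV[R]_m) : 'cV[R]_n :=
  \col_i sup [set r j 0 | j in [set j | j \in U i]].

Definition FI m n (U : 'I_n -> {set 'I_m}) (gamma : R) (r : 'cV[R]_m) :
    set 'cV[R]_n :=
  [set D | forall i k j, j \in U i -> gamma * D k 0 + r j 0 <= D i 0 <= 0].

Lemma hmaxP m n (U : 'I_n -> {set 'I_m}) (r : 'cV[R]_m) i :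
  U i != finset.set0 ->
  (exists2 j, j \in U i & hmax U r i 0 = r j 0) /\
  (forall j, j \in U i -> r j 0 <= hmax U r i 0).
Proof.
case/set0Pn => j0 j0U; rewrite mxE.
case: (@arg_maxP _ R _ j0 (mem (U i)) (fun j => r j 0) j0U) => j jU jmax.
have hub : ubound [set r k 0 | k in [set k | k \in U i]] (r j 0).
  by move=> _ [k kU <-]; exact: jmax.
have -> : sup [set r k 0 | k in [set k | k \in U i]] = r j 0.
  apply/eqP; rewrite eq_le; apply/andP; split.
    by apply: ge_sup => //; exists (r j 0), j.
  by apply: ub_le_sup; [exists (r j 0) | exists j].
by split; [exists j | move=> k; exact: jmax].
Qed.

Lemma opnormE m n (A : 'M[R]_(m, n)) :
  opnorm A = \big[Num.max/0]_j \sum_i `|A j i|.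
Proof.
have colE k (x : 'cV[R]_k) i : `|x i 0| <= `|x|.
  rewrite [leRHS]/Num.norm /= mx_normrE.
  by apply: (le_bigmax _ (fun ij => `|x ij.1 ij.2|) (i, 0)).
have colP k (x : 'cV[R]_k) b : 0 <= b -> (forall i, `|x i 0| <= b) -> `|x| <= b.
  move=> b0 xb; rewrite [leLHS]/Num.norm /= mx_normrE.
  by apply/bigmax_leP; split => // -[i o] _ /=; rewrite ord1.
set B := \big[_/_]_j _.
have B0 : 0 <= B by exact: bigmax_ge_id.
have hub : ubound [set `|A *m x| | x in [set x : 'cV[R]_n | `|x| <= 1]] B.
  move=> _ [x /= x1 <-]; apply: colP => // j; rewrite mxE.
  apply: (le_trans (ler_norm_sum _ _ _)).
  apply: (@le_trans _ _ (\sum_i `|A j i|)); last first.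
    exact: (le_bigmax _ (fun j => \sum_i `|A j i|) j).
  apply: ler_sum => i _; rewrite normrM ler_piMr//.
  exact: le_trans (colE _ x i) x1.
have ne : [set `|A *m x| | x in [set x : 'cV[R]_n | `|x| <= 1]] !=set0.
  by exists `|A *m (0 : 'cV[R]_n)|, 0 => //=; rewrite normr0.
apply/eqP; rewrite eq_le; apply/andP; split; first exact: ge_sup.
have le_op (x : 'cV[R]_n) : `|x| <= 1 -> `|A *m x| <= opnorm A.
  by move=> x1; apply: ub_le_sup; [exists B | exists x].
apply/bigmax_leP; split => [|j _].
  by apply: le_trans (le_op 0 _); rewrite ?normr0.
pose x : 'cV[R]_n := \col_i Num.sg (A j i).
have x1 : `|x| <= 1.
  by apply: colP => // i; rewrite mxE normr_sg; case: (_ != _).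
apply: le_trans (le_op x x1); apply: le_trans (colE _ _ j).
rewrite mxE; apply: le_trans (ler_norm _).
by rewrite le_eqVlt; apply/orP; left; apply/eqP; apply: eq_bigr => i _;
  rewrite mxE mulrC -normrEsg.
Qed.

End MDP.

Section iid.
Local Open Scope ereal_scope.

Definition mutually_independent (d d' : measure_display) (T : measurableType d)
    (T' : measurableType d') (R : realType) (P : probability T R)
    (I : choiceType) (X : I -> {RV P >-> T'}) : Prop :=
  forall (J : {fset I}) (B : I -> set T'), (forall i, measurable (B i)) ->
    P (\bigcap_(i in [set` J]) (X i @^-1` B i)) =
    \prod_(i <- J) P (X i @^-1` B i).

Definition identically_distributed (d d' : measure_display)
    (T : measurableType d) (T' : measurableType d') (R : realType)
    (P : probability T R) (I : Type) (X : I -> {RV P >-> T'}) : Prop :=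
  forall s t (B : set T'), measurable B ->
    distribution P (X s) B = distribution P (X t) B.

End iid.

(* Matrices with their Borel sigma-algebra. *)
Definition borel_mx (R : realType) (m n : nat) :=
  g_sigma_algebraType (@open 'M[R]_(m, n)).

(* Main.v *)
(* Almost surely the deviation never exceeds eps_min / 2, so concentration of
   measure plays no role.  Write H = |hmax R0|.  Along either recursion the
   state stays nonpositive and |hmax| contracts by alpha at each step, hence
   |h| <= alpha^t H / (1 - gamma) at time t.  As h <= 0, each coordinate of the
   increment (gamma A - S) h lies in [- gamma |h|, |h|] for every
   row-stochastic A, so two increments at time t differ by at most
   (1 + gamma) alpha^t H / (1 - gamma); summing over t gives eps_min / 2.  If
   eps > eps_min / 2 the event is negligible, and otherwise
   eps = eps_min = 0, where the claimed bound is 2. *)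
Require Import Defs.
From mathcomp Require Import ring lra.

Import Order.TTheory GRing.Theory Num.Theory.
Local Open Scope classical_set_scope.
Local Open Scope ring_scope.

Section controlled_dynamics.
Set Implicit Arguments.
Unset Strict Implicit.
Variables (R : realType) (m n : nat).
Implicit Types (A : 'M[R]_(m, n)) (x : 'cV[R]_n) (r : 'cV[R]_m).

(** * Sup norm and averaging by stochastic rows *)

Lemma cV_norm_coord k (x : 'cV[R]_k) i : `|x i 0| <= `|x|.
Proof.
rewrite [leRHS]/Num.norm /= mx_normrE.
exact: (le_bigmax _ (fun ij => `|x ij.1 ij.2|) (i, 0)).
Qed.

Lemma cV_norm_le k (x : 'cV[R]_k) b :
  0 <= b -> (forall i, `|x i 0| <= b) -> `|x| <= b.
Proof.
move=> b0 xb; rewrite [leLHS]/Num.norm /= mx_normrE.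
by apply/bigmax_leP; split => // -[i o] _ /=; rewrite ord1.
Qed.

Lemma row_stochastic_mul_ge A x j b :
  row_stochastic A -> (forall i, b <= x i 0) -> b <= (A *m x) j 0.
Proof.
move=> [A01 A1] bx; rewrite mxE -[b]mul1r -(A1 j) mulr_suml.
by apply: ler_sum => i _; apply: ler_wpM2l => //; case/andP: (A01 j i).
Qed.

Lemma row_stochastic_mul_le A x j b :
  row_stochastic A -> (forall i, x i 0 <= b) -> (A *m x) j 0 <= b.
Proof.
move=> Ast xb; have := @row_stochastic_mul_ge A (- x) j (- b) Ast.
by rewrite mulmxN mxE lerN2; apply => i; rewrite mxE lerN2.
Qed.

Variables (U : 'I_n -> {set 'I_m}).
Hypothesis Upart : action_partition U.

Lemma selection_mxE x i j : j \in U i -> (selection_mx R U *m x) j 0 = x i 0.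
Proof.
move=> jUi; rewrite mxE (bigD1 i)//= mxE jUi mul1r big1 ?addr0// => k ki.
rewrite mxE; have [jUk|_] := boolP (j \in U k); last by rewrite mul0r.
have [i' [_ uniq_i']] := Upart.2 j.
by rewrite -(uniq_i' _ jUi) -(uniq_i' _ jUk) eqxx in ki.
Qed.

Variables (gamma alpha : R) (h : 'cV[R]_m -> 'cV[R]_n).
Hypotheses (gamma01 : 0 <= gamma < 1) (alpha01 : 0 <= alpha < 1).
Hypothesis hP : forall r, (forall j, r j 0 <= 0) ->
  FI U gamma r (h r) /\
  forall i, h r i 0 + gamma * `|h r| <= hmax U r i 0 + alpha * `|hmax U r|.

(** [A] is a parameter so that the nominal and the perturbed recursion are both instances. *)
Let step A r := r + (gamma *: A - selection_mx R U) *m h r.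

Lemma stepE A r i j : j \in U i ->
  step A r j 0 = r j 0 + (gamma * (A *m h r) j 0 - h r i 0).
Proof.
by move=> jUi; rewrite -(selection_mxE (h r) jUi) /step mulmxBl -scalemxAl !mxE.
Qed.

(** * A single controlled step *)

Section one_step.
Variables (A : 'M[R]_(m, n)) (r : 'cV[R]_m).
Hypotheses (Ast : row_stochastic A) (r_le0 : forall j, r j 0 <= 0).

Lemma h_le0 i : h r i 0 <= 0.
Proof.
have [j jU] := set0Pn _ (Upart.1 i).
by have /andP[] := (hP r_le0).1 i i j jU.
Qed.

Lemma h_ge_norm i : - `|h r| <= h r i 0.
Proof. by have := cV_norm_coord (h r) i; rewrite ler_norml => /andP[]. Qed.

(** Taking [k = i] and a maximizing action [j] in [FI] gives
    [(1 - gamma) * h r i 0 >= hmax U r i 0], with both sides nonpositive. *)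
Lemma h_norm_le : `|h r| <= `|hmax U r| / (1 - gamma).
Proof.
case/andP: gamma01 => g0 g1.
apply: cV_norm_le => [|i]; first by rewrite divr_ge0// subr_ge0 ltW.
rewrite ler0_norm ?h_le0// ler_pdivlMr ?subr_gt0//.
have [[j jU hj] _] := hmaxP r (Upart.1 i).
have /andP[+ _] := (hP r_le0).1 i i j jU.
have := cV_norm_coord (hmax U r) i; rewrite hj ler_norml => /andP[+ _].
lra.
Qed.

(** [FI] bounds [gamma * h r k 0] by [h r i 0 - r j 0] for every [k], and row [j] of [A] averages
    over [k]. *)
Lemma step_le0 j : step A r j 0 <= 0.
Proof.
case/andP: gamma01 => g0 _.
have [i [jUi _]] := Upart.2 j.
rewrite (stepE _ _ jUi).
(* The averaging argument divides by [gamma]. *)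
have [g_eq0|g_neq0] := eqVneq gamma 0.
  by have /andP[+ _] := (hP r_le0).1 i i j jUi; rewrite g_eq0 !mul0r; lra.
have g_gt0 : 0 < gamma by rewrite lt_neqAle eq_sym g_neq0.
have : (A *m h r) j 0 <= (h r i 0 - r j 0) / gamma.
  apply: row_stochastic_mul_le => // k; rewrite ler_pdivlMr//.
  by have /andP[+ _] := (hP r_le0).1 i k j jUi; lra.
by rewrite ler_pdivlMr//; lra.
Qed.

(** The new maximum over [U i] is at least the new value at the old maximizer [j]. That value is at
    least [r j 0 - gamma * |h r| - h r i 0], which the second condition on [h] bounds below by
    [- alpha * |hmax U r|]. *)
Lemma hmax_step : `|hmax U (step A r)| <= alpha * `|hmax U r|.
Proof.
case/andP: gamma01 => g0 _; case/andP: alpha01 => a0 _.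
apply: cV_norm_le => [|i]; first exact: mulr_ge0.
have [[j' _ hj'] le_hmax] := hmaxP (step A r) (Upart.1 i).
have [[j jU hj] _] := hmaxP r (Upart.1 i).
rewrite ler0_norm; last by rewrite hj' step_le0.
have := le_hmax j jU; rewrite (stepE _ _ jU).
have := (hP r_le0).2 i; rewrite hj.
have := ler_wpM2l g0 (row_stochastic_mul_ge j Ast h_ge_norm).
lra.
Qed.

Lemma increment_bounds j :
  - (gamma * `|h r|) <= step A r j 0 - r j 0 <= `|h r|.
Proof.
case/andP: gamma01 => g0 _.
have [i [jUi _]] := Upart.2 j.
rewrite (stepE _ _ jUi).
have := ler_wpM2l g0 (row_stochastic_mul_ge j Ast h_ge_norm).
have := ler_wpM2l g0 (row_stochastic_mul_le j Ast h_le0).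
have := h_le0 i; have := h_ge_norm i.
by move=> ? ? ? ?; apply/andP; split; lra.
Qed.

End one_step.

(** * Geometric decay along trajectories *)

Section trajectory.
Variables (A : nat -> 'M[R]_(m, n)) (r : nat -> 'cV[R]_m).
Hypothesis Ast : forall t, row_stochastic (A t).
Hypothesis r0_le0 : forall j, r 0%N j 0 <= 0.
Hypothesis rS : forall t, r t.+1 = step (A t) (r t).

Lemma trajectory_le0 t j : r t j 0 <= 0.
Proof.
by elim: t j => // t IH j; rewrite rS; exact: step_le0.
Qed.

Lemma trajectory_hmax t : `|hmax U (r t)| <= alpha ^+ t * `|hmax U (r 0%N)|.
Proof.
case/andP: alpha01 => a0 _.
elim: t => [|t IH]; first by rewrite expr0 mul1r.
rewrite rS (le_trans (hmax_step (Ast t) (trajectory_le0 t)))//.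
by rewrite exprS -mulrA ler_wpM2l.
Qed.

Lemma trajectory_h t :
  `|h (r t)| <= alpha ^+ t * `|hmax U (r 0%N)| / (1 - gamma).
Proof.
case/andP: gamma01 => _ g1.
apply: le_trans (h_norm_le (trajectory_le0 t)) _.
by rewrite ler_pM2r ?invr_gt0 ?subr_gt0// trajectory_hmax.
Qed.

End trajectory.

Lemma trajectory_dist (A B : nat -> 'M[R]_(m, n)) (r s : nat -> 'cV[R]_m) t :
  (forall t, row_stochastic (A t)) -> (forall t, row_stochastic (B t)) ->
  (forall j, r 0%N j 0 <= 0) -> s 0%N = r 0%N ->
  (forall t, r t.+1 = step (A t) (r t)) ->
  (forall t, s t.+1 = step (B t) (s t)) ->
  `|s t - r t| <= (1 + gamma) / ((1 - alpha) * (1 - gamma)) * `|hmax U (r 0%N)|.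
Proof.
move=> Ast Bst r0 sr0 rS sS.
have s0 j : s 0%N j 0 <= 0 by rewrite sr0.
case/andP: gamma01 => g0 g1; case/andP: alpha01 => a0 a1.
have g1' : 0 < 1 - gamma by rewrite subr_gt0.
have a1' : 0 < 1 - alpha by rewrite subr_gt0.
set H := `|hmax U (r 0%N)|; have H0 : 0 <= H by exact: normr_ge0.
have K0 : 0 <= (1 + gamma) / ((1 - alpha) * (1 - gamma)) * H.
  by rewrite mulr_ge0// divr_ge0 ?mulr_ge0 ?(ltW g1') ?(ltW a1')// addr_ge0.
have a_t_ge0 : 0 <= alpha ^+ t by exact: exprn_ge0.
(* The bound is the partial sum of [(1 + gamma) * alpha ^+ k * H / (1 - gamma)] over [k < t'], in
   closed form so that the induction goes through. *)
have step_dist j t' : `|s t' j 0 - r t' j 0| <=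
    (1 - alpha ^+ t') * ((1 + gamma) / ((1 - alpha) * (1 - gamma)) * H).
  elim: t' => [|t' IH]; first by rewrite sr0 subrr normr0 expr0 subrr mul0r.
  have := increment_bounds (Ast t') (trajectory_le0 Ast r0 rS t') j.
  have := increment_bounds (Bst t') (trajectory_le0 Bst s0 sS t') j.
  rewrite -rS -sS.
  have := trajectory_h Ast r0 rS t'; have := trajectory_h Bst s0 sS t'.
  rewrite sr0 -/H.
  set b := alpha ^+ t' * H / (1 - gamma) => hs hr.
  have ghs := ler_wpM2l g0 hs; have ghr := ler_wpM2l g0 hr.
  move=> /andP[s1 s2] /andP[r1 r2].
  have -> : (1 - alpha ^+ t'.+1) *
      ((1 + gamma) / ((1 - alpha) * (1 - gamma)) * H) =
      (1 - alpha ^+ t') * ((1 + gamma) / ((1 - alpha) * (1 - gamma)) * H) +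
      (1 + gamma) * b.
    by rewrite /b exprS; field; rewrite !gt_eqF.
  by move: IH; rewrite !ler_norml => /andP[? ?]; apply/andP; split; lra.
apply: cV_norm_le => // j; rewrite !mxE.
apply: le_trans (step_dist j t) _.
by rewrite ler_piMl// lerBlDr lerDl.
Qed.

End controlled_dynamics.

(** * From the pathwise bound to the probability *)

Lemma negligible_mu_ext d (T : measurableType d) (R : realType)
    (mu : {measure set T -> \bar R}) (A : set T) :
  mu.-negligible A -> ((mu^*)%mu A = 0)%E.
Proof.
move=> [N [mN N0 AN]]; apply/eqP; rewrite eq_le; apply/andP.
split; last exact: mu_ext_ge0.
by rewrite -N0 -measurable_mu_extE//; exact: le_mu_ext.
Qed.

(* [P^*] is the outer measure of P.  It equals P on measurable sets
   ([measurable_mu_extE]) and gives a meaning to the probability of the event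
   without any measurability assumption on h.  The exponent is computed in
   \bar R, where 1 / 0 = +oo and 0 * +oo = 0, so that mu = 0, gamma = 0 or
   hmax U R0 = 0 are covered as limit cases. *)
Theorem theorem40 (R : realType) (n m : nat)
    (U : 'I_n -> {set 'I_m}) (F : 'M[R]_(m, n)) (gamma mu alpha : R)
    (d : measure_display) (T : measurableType d) (P : probability T R)
    (Fhat : nat -> {RV P >-> borel_mx R m n})
    (h : 'cV[R]_m -> 'cV[R]_n)
    (R0 : 'cV[R]_m) (Rnom : nat -> 'cV[R]_m) (Rhat : nat -> T -> 'cV[R]_m) :
  let S := selection_mx R U in
  action_partition U ->
  row_stochastic F ->
  0 <= gamma < 1 ->
  mutually_independent Fhat ->
  identically_distributed Fhat ->
  (forall t, {ae P, forall w, row_stochastic (Fhat t w : 'M[R]_(m, n))}) ->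
  (forall t j i,
    'E_P[fun w => (Fhat t w : 'M[R]_(m, n)) j i] = (F j i)%:E)%E ->
  (forall t, {ae P, forall w, opnorm ((Fhat t w : 'M[R]_(m, n)) - F) <= mu}) ->
  0 <= alpha < 1 ->
  (forall r : 'cV[R]_m, (forall j, r j 0 <= 0) ->
    FI U gamma r (h r) /\
    forall i, h r i 0 + gamma * `|h r| <= hmax U r i 0 + alpha * `|hmax U r|) ->
  (forall j, R0 j 0 <= 0) ->
  Rnom 0%N = R0 ->
  (forall t, Rnom t.+1 = Rnom t + (gamma *: F - S) *m h (Rnom t)) ->
  (forall w, Rhat 0%N w = R0) ->
  (forall t w, Rhat t.+1 w =
    Rhat t w + (gamma *: (Fhat t w : 'M[R]_(m, n)) - S) *m h (Rhat t w)) ->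
  let eps_min := 2 * ((1 + gamma) / ((1 - alpha) * (1 - gamma))) *
                 `|hmax U R0| in
  let c := (((1 - alpha ^+ 2) * (1 - gamma) ^+ 2)%:E /
            (2 * mu ^+ 2 * gamma ^+ 2)%:E)%E in
  forall eps : R, eps_min <= eps ->
  ((P^*)%mu [set w | eps%:E <=
      ereal_sup [set `|Rhat t w - Rnom t|%:E | t in [set: nat]]] <=
   2%:E * expeR (- (c * (((eps - eps_min) ^+ 2)%:E /
                         (`|hmax U R0| ^+ 2)%:E))))%E.
Proof.
move=> S Upart Fst gamma01 _ _ Fhat_st _ _ alpha01 hP R0_le0 Rnom0 RnomS
  Rhat0 RhatS eps_min c eps le_eps.
have dist w : (forall t, row_stochastic (Fhat t w : 'M[R]_(m, n))) ->
    forall t, `|Rhat t w - Rnom t| <= eps_min / 2.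
  move=> Fhatw t.
  have -> : eps_min / 2 =
      (1 + gamma) / ((1 - alpha) * (1 - gamma)) * `|hmax U (Rnom 0%N)|.
    by rewrite /eps_min Rnom0; set K := (1 + gamma) / _; field.
  apply: (@trajectory_dist _ _ _ _ Upart _ _ _ gamma01 alpha01 hP (fun=> F)
    (fun t => Fhat t w) Rnom (Rhat^~ w)) => //.
  - by rewrite Rnom0.
  - by rewrite Rhat0 Rnom0.
have rhs_ge0 x : (0 <= 2%:E * expeR x)%E.
  by rewrite mule_ge0 ?expeR_ge0// lee_fin.
have eps_min_ge0 : 0 <= eps_min.
  case/andP: gamma01 => ? ?; case/andP: alpha01 => ? ?.
  have K0 : 0 <= (1 + gamma) / ((1 - alpha) * (1 - gamma)).
    by rewrite divr_ge0 ?addr_ge0// mulr_ge0// subr_ge0 ltW.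
  by apply: mulr_ge0 => //; apply: mulr_ge0.
have [lt_eps|ge_eps] := ltP (eps_min / 2) eps.
  rewrite negligible_mu_ext//.
  (* Countably many almost sure events hold simultaneously; outside the event where all [Fhat t w]
     are stochastic nothing is claimed. *)
  apply: negligibleS (ae_foralln Fhat_st) => w /= eps_le Fhatw.
  suff : (eps%:E <= (eps_min / 2)%:E)%E by rewrite lee_fin leNgt lt_eps.
  apply: le_trans eps_le _; apply/ereal_supP => _ [t _ <-].
  by rewrite lee_fin dist.
(* Here [eps_min <= eps <= eps_min / 2] with [eps_min >= 0], so both vanish. The zero numerator then
   kills the exponent even if [c] or the inverse of the squared norm is [+oo]. *)
have -> : eps - eps_min = 0 by lra.
rewrite expr0n /= mul0e mule0 oppe0 expeR0 mule1.
apply: (@le_trans _ _ 1%E); last by rewrite lee_fin ler1n.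
apply: le_trans (le_mu_ext P (@subsetT _ _)) _.
by rewrite measurable_mu_extE//; exact: probability_le1.
Qed.
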